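(* Let $\Gamma$ be a finite connected undirected graph with vertex set $V$, and let $\Delta$ be its canonical edge Laplacian. (1) $\Delta$ has spectrum (as a multiset of eigenvalues counted with algebraic multiplicity) $$\mathrm{Spec}(\Delta)=2\,\mathrm{Spec}(L)\ \cup\ \{\deg(x)\ (\text{with algebraic multiplicity } \deg(x)-1)\mid x\in V\},$$ where $L$ is the usual graph Laplacian on vertices and $\deg(x)$ is the degree of $x$. (2) Over $\mathbb R$, $\Delta$ is triangularisable and its spectrum is strictly positive aside from one zero mode $\theta$. (3) Over $\mathbb R$, $\Delta$ is fully diagonalisable if the two parts $2\,\mathrm{Spec}(L)$ and $\{\deg(x)\ (\text{with algebraic multiplicity }\deg(x)-1)\mid x\in V\}$ of the spectrum are disjoint.
   Context: $k$ is a ground field of characteristic not $2$ ($k=\mathbb R$ in (2), (3)). Graphs have no loops or multiple edges; an undirected graph is viewed as a bidirected digraph with arrows $x\to y$ and $y\to x$ for every edge. $\Omega^1$ is the $k$-vector space with basis $\{\omega_{x\to y}\}$ indexed by all arrows (so of dimension twice the number of undirected edges), and $\theta=\sum_{x\to y}\omega_{x\to y}$. The canonical edge Laplacian is the linear map $\Delta:\Omega^1\to\Omega^1$ given by $$\Delta\omega_{x\to y}=\deg(x)\,\omega_{x\to y}-2\sum_{z:\,y\to z}\omega_{y\to z}+\sum_{z:\,x\to z}\omega_{x\to z}.$$ (It is the Laplace-Beltrami operator on 1-forms for the canonical connection $\nabla\omega=\theta\otimes_{k(V)}\omega-\omega\otimes_{k(V)}\theta$ and the inverse Euclidean metric $(\omega_{x\to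 y},\omega_{y'\to x'})=\delta_{x,x'}\delta_{y,y'}\delta_x$, where $k(V)$ is the algebra of functions $V\to k$ and $\delta_x\in k(V)$ is the Kronecker delta function at $x$.) The graph Laplacian on functions $f:V\to k$ is $(Lf)(x)=\sum_{y:\,x\to y}(f(x)-f(y))$. $2\,\mathrm{Spec}(L)$ is the multiset of eigenvalues of $2L$. A vertex of degree $1$ contributes nothing to the second part. *)

(* Defs.v *)
From HB Require Import structures.
From mathcomp Require Import all_boot all_order all_algebra.
From mathcomp Require Import reals.

Set Implicit Arguments.
Unset Strict Implicit.
Unset Printing Implicit Defensive.

Import Order.TTheory GRing.Theory Num.Theory.
Local Open Scope ring_scope.

(* A multiset of elements of K is represented by its multiplicity function
   K -> nat; union of multisets is pointwise addition.

   spectrum A a is the algebraic multiplicity of a as an eigenvalue of A.  It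
   only sees the eigenvalues lying in K; to see those of a matrix over k that
   lie in an extension iota : k -> K, use spectrum (map_mx iota A). *)
Definition spectrum (K : fieldType) (n : nat) (A : 'M[K]_n) : K -> nat :=
  fun a => mup a (char_poly A).

Definition multiset_disjoint (K : fieldType) (m1 m2 : K -> nat) : Prop :=
  forall a, ~ ((0 < m1 a)%N /\ (0 < m2 a)%N).

Section Graph.
Variables (V : finType) (e : rel V).

Definition graph_connected : Prop := forall x y, connect e x y.

Definition deg (x : V) : nat := #|[pred y | e x y]|.

Definition arrow : finType := {a : V * V | e a.1 a.2}.
Definition src (a : arrow) : V := (val a).1.
Definition tgt (a : arrow) : V := (val a).2.

(* The degree part of the spectrum.  Distinct degrees may coincide in K when K
   has positive characteristic: their multiplicities then add up. *)
Definition degree_spectrum (K : fieldType) : K -> nat :=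
  fun a => (\sum_(x : V | (deg x)%:R == a) (deg x).-1)%N.

Section Laplacians.
Variable k : fieldType.

Definition graph_laplacian (f : V -> k) : V -> k :=
  fun x => \sum_(y : V | e x y) (f x - f y).

(* Matrices act on row vectors on the right, so row i of the matrix of a
   linear map holds the coordinates of the image of the i-th basis vector,
   here the Kronecker delta function at the i-th vertex. *)
Definition graph_laplacian_mx : 'M[k]_#|V| :=
  \matrix_(i, j) graph_laplacian (fun z => (z == enum_val i)%:R) (enum_val j).

Definition Omega1 := 'rV[k]_#|arrow|.

Definition omega (a : arrow) : Omega1 := delta_mx 0 (enum_rank a).

Definition theta : Omega1 := \sum_(a : arrow) omega a.

Definition edge_laplacian_omega (a : arrow) : Omega1 :=
  (deg (src a))%:R *: omega a
  - 2%:R *: (\sum_(b : arrow | src b == tgt a) omega b)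
  + \sum_(b : arrow | src b == src a) omega b.

(* The linear map u |-> u *m edge_laplacian_mx of Omega1 is the linear
   extension of edge_laplacian_omega: see omega_edge_laplacian. *)
Definition edge_laplacian_mx : 'M[k]_#|arrow| :=
  \matrix_(i < #|arrow|) edge_laplacian_omega (enum_val i).

Lemma omega_edge_laplacian a :
  omega a *m edge_laplacian_mx = edge_laplacian_omega a.
Proof. by rewrite /omega -rowE rowK enum_rankK. Qed.

Lemma graph_laplacian_mxE (f : V -> k) :
  (\row_i f (enum_val i)) *m graph_laplacian_mx
  = \row_j graph_laplacian f (enum_val j).
Proof.
apply/rowP => j; rewrite !mxE.
under eq_bigr => i _ do rewrite !mxE /graph_laplacian mulr_sumr.
rewrite exchange_big /graph_laplacian /=; apply: eq_bigr => y _.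
have fE z : \sum_(i < #|V|) f (enum_val i) * (z == enum_val i)%:R = f z.
  rewrite (bigD1 (enum_rank z)) //= enum_rankK eqxx mulr1 big1 ?addr0 // => i ne_i.
  by rewrite [z == _]negbTE ?mulr0 //; apply: contraNneq ne_i => ->; rewrite enum_valK.
under eq_bigr => i _ do rewrite mulrBr.
by rewrite sumrB !fE.
Qed.

End Laplacians.
End Graph.

Arguments degree_spectrum {V} e K.
Arguments graph_laplacian_mx {V} e k.
Arguments theta {V} e k.
Arguments edge_laplacian_mx {V} e k.

(* Main.v *)
Require Import Defs.
From HB Require Import structures.
From mathcomp Require Import all_boot all_order all_algebra.
From mathcomp Require Import reals complex ring.

Set Implicit Arguments.
Unset Strict Implicit.
Unset Printing Implicit Defensive.

Import Order.TTheory GRing.Theory Num.Theory.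
Local Open Scope ring_scope.

(** Let S and T be the arrows-by-vertices incidence matrices of sources and of
    targets, D the diagonal matrix of vertex degrees and E the diagonal matrix
    holding the degree of the source of each arrow.  With row vectors, the
    edge Laplacian is a perturbation of E of rank at most #|V|,
      Delta = E + (S - 2 T) S^T,
    and the three relations S^T E = D S^T, S^T S = D and S^T T = D - L give
      S^T Delta = (2 L) S^T,   2 L = D + S^T (S - 2 T).
    So the functions pulled back along the source map, the row space of S^T,
    form an invariant subspace on which Delta is 2 L, and on the quotient Delta
    acts as E.

    (1) Sylvester's determinant identity, in the form char_poly_lowrank, reads
    chi_D chi_Delta = chi_E chi_(2L).  A vertex x has deg x outgoing arrows, so
    the factor X - deg x occurs deg x times in chi_E and once in chi_D, which
    leaves deg x - 1 of them once chi_D is cancelled: char_poly_edge_laplacian.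

    (2) L is real symmetric, so it is diagonalisable over R and chi_Delta splits
    over R, which is enough to triangularise Delta (trigonalizable_split).  The
    eigenvalues of 2 L are nonnegative, and the eigenvalue 0 is simple with
    constant eigenvectors, because of the Dirichlet form
      2 <L f, f> = sum over arrows x -> y of (f x - f y)^2
    and of connectedness.  Degrees are positive, so 0 comes from the constants
    alone, whose pullback is theta.

    (3) Eigenvectors of Delta can be written down.  Those of 2 L pull back to a
    spanning set of the row space of S^T.  If the degree d of the source of an
    arrow a is not an eigenvalue of 2 L, then d - 2 L is invertible and omega_a
    can be corrected by some g S^T to an eigenvector for d (eigenvector_lift).
    If d = 1, then d need not occur in the degree part of the spectrum and may
    well be an eigenvalue of 2 L; but then a is the only arrow leaving its
    source, and omega_a is itself a row of S^T. *)

(** * Characteristic polynomials *)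

Lemma mup_prod_XsubC (F : fieldType) (I : finType) (r : I -> F)
    (m : I -> nat) a :
  mup a (\prod_i ('X - (r i)%:P) ^+ m i) = (\sum_(i | r i == a) m i)%N.
Proof.
rewrite [RHS]big_mkcond.
suff [->] : mup a (\prod_i ('X - (r i)%:P) ^+ m i) =
              (\sum_i if r i == a then m i else 0)%N
            /\ \prod_i ('X - (r i)%:P) ^+ m i != 0 by [].
apply: (big_rec2 (fun p n => mup a p = n /\ p != 0)) => [|i n p _ [<- p0]].
  by split; rewrite ?oner_eq0 // mupNroot // root1.
have Xm0 : ('X - (r i)%:P) ^+ m i != 0 by rewrite expf_neq0 // polyXsubC_eq0.
by rewrite mupM // mup_XsubCX mulf_neq0.
Qed.

Lemma spectrum_gt0 (K : fieldType) n (A : 'M[K]_n) a :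
  (0 < spectrum A a)%N = eigenvalue A a.
Proof.
rewrite eigenvalue_root_char -dvdp_XsubCl -[_ - _]expr1.
by rewrite -mup_geq // monic_neq0 ?char_poly_monic.
Qed.

Lemma char_poly_diag (R : comNzRingType) n (d : 'rV[R]_n) :
  char_poly (diag_mx d) = \prod_i ('X - (d 0 i)%:P).
Proof.
rewrite char_poly_trig ?diag_mx_is_trig //.
by apply: eq_bigr => i _; rewrite mxE eqxx.
Qed.

Lemma char_poly_similar (F : fieldType) n (P A B : 'M[F]_n) :
  P \in unitmx -> P *m A = B *m P -> char_poly A = char_poly B.
Proof.
move=> Pu PA; rewrite /char_poly.
have P0 : \det (map_mx polyC P) != 0.
  by rewrite det_map_mx polyC_eq0 -unitfE -unitmxE.
apply: (mulfI P0); rewrite [RHS]mulrC -!det_mulmx; congr (\det _).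
by rewrite /char_poly_mx mulmxBr mulmxBl -!map_mxM PA scalar_mxC.
Qed.

Lemma char_poly_lblock (R : comNzRingType) m n (A : 'M[R]_m) (B : 'M_(n, m))
    (C : 'M_n) : char_poly (block_mx A 0 B C) = char_poly A * char_poly C.
Proof.
rewrite /char_poly /char_poly_mx map_block_mx map_mx0 scalar_mx_block.
by rewrite opp_block_mx add_block_mx oppr0 addr0 det_lblock.
Qed.

(** The row space of W is stable under E + N W, which acts on it as D + W N. *)
Lemma lowrank_intertwine (R : pzRingType) m n (E : 'M[R]_m) (D : 'M[R]_n)
    (N : 'M_(m, n)) (W : 'M_(n, m)) : W *m E = D *m W ->
  W *m (E + N *m W) = (D + W *m N) *m W.
Proof. by move=> WE; rewrite mulmxDr mulmxDl WE mulmxA. Qed.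

(** Sylvester's identity det (X - E - N W) = det (X - E) det (1 - W (X - E)^-1 N)
    in a form without denominators: since W (X - E)^-1 = (X - D)^-1 W,
    multiplying by det (X - D) clears them.  Both sides are the determinant of
    the block matrix B of the proof, reduced on the right and on the left. *)
Lemma char_poly_lowrank (R : comNzRingType) m n (E : 'M[R]_m) (D : 'M[R]_n)
    (N : 'M_(m, n)) (W : 'M_(n, m)) : W *m E = D *m W ->
  char_poly D * char_poly (E + N *m W) = char_poly E * char_poly (D + W *m N).
Proof.
move=> WE; pose p k l (A : 'M[R]_(k, l)) := map_mx polyC A.
have pWE : p _ _ W *m char_poly_mx E = char_poly_mx D *m p _ _ W.
  by rewrite /char_poly_mx mulmxBr mulmxBl -!map_mxM WE scalar_mxC.
pose B := block_mx (char_poly_mx E) (p _ _ N)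
                   (char_poly_mx D *m p _ _ W) (char_poly_mx D).
have <- : \det B = char_poly D * char_poly (E + N *m W).
  (* Column operation: subtract the second block column times W. *)
  have -> : B = block_mx (char_poly_mx (E + N *m W)) (p _ _ N) 0 (char_poly_mx D)
                *m block_mx 1%:M 0 (p _ _ W) 1%:M.
    rewrite mulmx_block !mulmx1 !mul0mx !mulmx0 !add0r.
    by rewrite /char_poly_mx raddfD /= map_mxM opprD addrA addrNK.
  by rewrite det_mulmx det_ublock det_lblock !det1 !mulr1 mulrC.
(* Row operation: subtract W times the first block row. *)
have <- : \det (block_mx 1%:M 0 (- p _ _ W) 1%:M *m B) =
          char_poly E * char_poly (D + W *m N).
  rewrite mulmx_block !mul1mx !mul0mx !addr0 !mulNmx -pWE addNr.
  rewrite det_ublock; congr (_ * \det _).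
  by rewrite addrC /char_poly_mx raddfD /= map_mxM opprD addrA.
by rewrite det_mulmx det_lblock !det1 !mul1r.
Qed.

(** * Triangular and diagonal forms *)

(** Peel off one root at a time: completing an eigenvector to a basis makes the
    matrix block lower triangular, and the remaining block has the remaining
    roots. *)
Lemma trigonalizable_split (F : fieldType) n (A : 'M[F]_n) (rs : seq F) :
  char_poly A = \prod_(r <- rs) ('X - r%:P) ->
  trigonalizable A.
Proof.
elim: n A rs => [|n IHn] A rs chA.
  by exists 1%:M; rewrite ?unitmx1 //; apply/is_trig_mxP => -[].
case: rs => [|r rs] in chA *.
  by have := size_char_poly A; rewrite chA big_nil size_poly1.
have /eigenvalueP[v vA v0] : eigenvalue A r.
  by rewrite eigenvalue_root_char chA big_cons rootM root_XsubC eqxx.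
pose P : 'M[F]_(1 + n) := row_ebase v.
have Pu : P \in unitmx := row_ebase_unit v.
(* The first row of the extended row base of v is a multiple of v. *)
have vP : v = col_ebase v 0 0 *: row 0 P.
  rewrite -[LHS]mulmx_ebase rank_rV v0 [col_ebase v]mx11_scalar mul_scalar_mx.
  rewrite -scalemxAl; congr (_ *: _).
    by rewrite !mxE eqxx.
  apply/rowP => j; rewrite !mxE big_ord_recl big1 => [|i _].
    by rewrite !mxE /= mul1r addr0.
  by rewrite !mxE /= mul0r.
have c0 : col_ebase v 0 0 != 0.
  by apply: contraNneq v0 => c0; rewrite vP c0 scale0r.
have rA : row 0 P *m A = r *: row 0 P.
  apply: (scalerI c0); rewrite scalerA mulrC -scalerA -vP.
  by rewrite scalemxAl -vP vA.
pose B : 'M[F]_(1 + n) := P *m A *m invmx P.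
have PA : P *m A = B *m P by rewrite mulmxKV.
have B0 : usubmx B = row_mx r%:M 0.
  have -> : usubmx B = row 0 B.
    apply/matrixP => i j; rewrite ord1 [LHS]mxE [RHS]mxE.
    by congr (B _ _); apply/val_inj.
  rewrite !row_mul rA -scalemxAl -row_mul mulmxV // row1.
  apply/rowP => j; rewrite !mxE; case: splitP => k; rewrite !mxE ?ord1 => jk.
    by rewrite eqxx (_ : j == 0) ?mulr1 // -val_eqE /= jk.
  by rewrite andTb (_ : (j == 0) = false) ?mulr0 // -val_eqE /= jk.
clearbody B; have BE : B = block_mx r%:M 0 (dlsubmx B) (drsubmx B).
  by rewrite -[B in LHS]vsubmxK B0 -[dsubmx B]hsubmxK.
have chB : char_poly (drsubmx B) = \prod_(r <- rs) ('X - r%:P).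
  have X0 : 'X - r%:P != 0 by rewrite polyXsubC_eq0.
  apply: (mulfI X0); rewrite big_cons in chA; rewrite -chA.
  rewrite (char_poly_similar Pu PA) [in RHS]BE char_poly_lblock.
  by rewrite char_poly_trig ?scalar_mx_is_trig // big_ord1 mxE eqxx.
have [Q Qu QT] := IHn _ _ chB.
have [T TE trT] : exists2 T, Q *m drsubmx B = T *m Q & is_trig_mx T.
  by exists (conjmx Q (drsubmx B)) => //; apply/(similarP Qu)/eqP.
pose Q1 : 'M[F]_(1 + n) := block_mx 1%:M 0 0 Q.
have Q1u : Q1 \in unitmx by rewrite unitmxE det_lblock det1 mul1r -unitmxE.
have Q1Pu : Q1 *m P \in unitmx by rewrite unitmx_mul Q1u.
exists (Q1 *m P) => //.
pose T1 : 'M[F]_(1 + n) := block_mx r%:M 0 (Q *m dlsubmx B) T.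
suff /eqP simT : similar (Q1 *m P) A T1.
  rewrite /similar_to simT /T1 /= (@is_trig_block_mx _ 1 n 1 n) // eqxx trT.
  by rewrite scalar_mx_is_trig.
apply/(similarP Q1Pu).
rewrite -mulmxA PA !mulmxA; congr (_ *m _); rewrite BE !mulmx_block.
by rewrite !mul1mx !mul0mx !mulmx0 !mulmx1 !addr0 !add0r TE.
Qed.

(** A criterion by spanning: each basis vector need only be a sum of eigenvectors
    with eigenvalues in rs. *)
Lemma diagonalizable_eigensum (F : fieldType) n (A : 'M[F]_n) (rs : seq F) :
  (1%:M <= \sum_(r <- undup rs) eigenspace A r)%MS ->
  diagonalizable A.
Proof.
move=> full; apply/diagonalizablePeigen.
by exists (undup rs); [apply: undup_uniq | apply/eqmxP; rewrite submx1].
Qed.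

Lemma sub_eigensum (F : fieldType) n (A : 'M[F]_n) (rs : seq F) r (u : 'rV_n) :
  r \in rs -> u *m A = r *: u -> (u <= \sum_(r <- undup rs) eigenspace A r)%MS.
Proof.
move=> rrs /eigenspaceP uA.
by rewrite (big_rem r) ?mem_undup //= (submx_trans uA) ?addsmxSl.
Qed.

(** The equation to solve is u N + g (D + W N) = c g, which has a solution g
    because c - (D + W N) is invertible. *)
Lemma eigenvector_lift (F : fieldType) m n (E : 'M[F]_m) (D : 'M[F]_n)
    (N : 'M_(m, n)) (W : 'M_(n, m)) c (u : 'rV_m) :
  W *m E = D *m W -> u *m E = c *: u -> ~~ eigenvalue (D + W *m N) c ->
  exists g, (u + g *m W) *m (E + N *m W) = c *: (u + g *m W).
Proof.
move=> WE uE; rewrite negbK kermx_eq0 row_free_unit => Hu.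
exists (- (u *m N *m invmx (D + W *m N - c%:M))); set g := - _.
have gH : g *m (D + W *m N) = c *: g - u *m N.
  have : g *m (D + W *m N - c%:M) = - (u *m N) by rewrite mulNmx mulmxKV.
  by rewrite mulmxBr mul_mx_scalar => /eqP; rewrite subr_eq [- _ + _]addrC => /eqP.
rewrite mulmxDl -mulmxA (lowrank_intertwine N WE) [g *m _]mulmxA gH.
by rewrite mulmxDr mulmxBl uE scalerDr scalemxAl !mulmxA addrA addrAC addrK.
Qed.

(** Over the algebraic closure R[i] the matrix is normal with a real spectrum, by
    the spectral theorem; and real matrices similar over R[i] are similar by a
    real base change. *)
Lemma real_symmetric_diag (R : rcfType) n (A : 'M[R]_n) : A^T = A ->
  exists2 P : 'M_n, P \in unitmx & exists d, P *m A = diag_mx d *m P.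
Proof.
move=> symA.
have realC m p (B : 'M[R]_(m, p)) : map_mx (real_complex R) B \is a mxOver Num.real.
  by apply/mxOverP => i j; rewrite mxE complex_real.
have ofC m p (B : 'M[R[i]]_(m, p)) : B \is a mxOver Num.real ->
    map_mx (real_complex R) (map_mx (@complex.Re R) B) = B.
  by move=> /mxOverP rB; apply/matrixP => i j; rewrite !mxE RRe_real.
set AC := map_mx (real_complex R) A.
have symAC : AC \is symmetricmx.
  by apply/is_hermitianmxP; rewrite expr0 scale1r map_mx_id // map_trmx symA.
have /orthomx_spectralP ACE := symmetric_normalmx symAC (realC _ _ A).
have dR := hermitian_spectral_diag_real (realsym_hermsym symAC (realC _ _ A)).
pose P := spectralmx AC; pose d := spectral_diag AC.
have Pu : P \in unitmx := spectral_unit AC.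
have simAC : similar P AC (diag_mx d).
  by apply/(similarP Pu); rewrite [AC in LHS]ACE !mulmxA mulmxV // mul1mx.
have dC : diag_mx d \is a mxOver Num.real by rewrite mxOver_diag // dR.
have [Q /andP[/ofC QE Qu] /(similarP Qu) QA] :=
  real_similar (ex_intro2 _ _ P Pu simAC) (realC _ _ A) dC.
exists (map_mx (@complex.Re R) Q).
  by rewrite -(map_unitmx (real_complex R)) QE.
exists (map_mx (@complex.Re R) d).
apply: (@map_mx_inj _ _ (real_complex R)).
by rewrite !map_mxM map_diag_mx QE [X in diag_mx X]ofC // QA.
Qed.


(** * The edge Laplacian as a perturbation of low rank *)

Section Incidence.
Variables (V : finType) (e : rel V) (K : fieldType).

Definition src_mx : 'M[K]_(#|arrow e|, #|V|) :=
  \matrix_(a, x) (src (enum_val a) == enum_val x)%:R.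
Definition tgt_mx : 'M[K]_(#|arrow e|, #|V|) :=
  \matrix_(a, x) (tgt (enum_val a) == enum_val x)%:R.
Definition deg_row : 'rV[K]_#|V| := \row_x (deg e (enum_val x))%:R.
Definition src_deg_row : 'rV[K]_#|arrow e| :=
  \row_a (deg e (src (enum_val a)))%:R.

Lemma big_arrow (R : Type) (idx : R) (op : Monoid.com_law idx)
    (f : V -> V -> R) :
  \big[op/idx]_(a < #|arrow e|) f (src (enum_val a)) (tgt (enum_val a)) =
  \big[op/idx]_x \big[op/idx]_(y | e x y) f x y.
Proof.
rewrite -(big_enum_val (fun a : arrow e => f (src a) (tgt a))) /=.
rewrite -(big_sub (fun p : V * V => e p.1 p.2) (fun p => f p.1 p.2)).
by rewrite pair_big_dep.
Qed.

Lemma sum_vertex_delta (f : V -> K) z :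
  \sum_(x < #|V|) (z == enum_val x)%:R * f (enum_val x) = f z.
Proof.
rewrite -(big_enum_val (fun x => (z == x)%:R * f x)) /= (bigD1 z) //= eqxx.
by rewrite mul1r big1 ?addr0 // => x /negPf; rewrite eq_sym => ->; rewrite mul0r.
Qed.

Lemma src_mx_deg :
  src_mx^T *m diag_mx src_deg_row = diag_mx deg_row *m src_mx^T.
Proof.
rewrite mul_mx_diag mul_diag_mx; apply/matrixP => x a; rewrite !mxE.
by case: eqP => [->|]; rewrite ?mul0r ?mulr0 // mulrC.
Qed.

Lemma edge_laplacian_mxE :
  edge_laplacian_mx e K =
  diag_mx src_deg_row + (src_mx - 2%:R *: tgt_mx) *m src_mx^T.
Proof.
have sum_omega x (b : 'I_#|arrow e|) :
    (\sum_(a : arrow e | src a == x) omega K a) 0 b = (src (enum_val b) == x)%:R.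
  rewrite summxE big_mkcond /= (bigD1 (enum_val b)) //= big1 => [|a ne_a].
    by rewrite mxE enum_valK !eqxx addr0; case: eqP.
  rewrite mxE /=; case: (b =P _) => [b_a|_]; last by case: ifP.
  by rewrite b_a enum_rankK eqxx in ne_a.
have delta (E : 'M[K]_(#|arrow e|, #|V|)) (t : arrow e -> V) :
    (forall a x, E a x = (t (enum_val a) == enum_val x)%:R) ->
    forall a b, (E *m src_mx^T) a b = (src (enum_val b) == t (enum_val a))%:R.
  move=> EE a b; rewrite mxE.
  under eq_bigr => x _ do rewrite EE !mxE.
  by rewrite (sum_vertex_delta (fun x => (src (enum_val b) == x)%:R)).
have srcE := delta src_mx (@src V e) (fun a x => mxE _ _ a x).
have tgtE := delta tgt_mx (@tgt V e) (fun a x => mxE _ _ a x).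
rewrite mulmxBl -scalemxAl.
move: (src_mx *m _) (tgt_mx *m _) srcE tgtE => X Y XE YE.
apply/matrixP => a b; rewrite !mxE !sum_omega XE YE.
rewrite -addrA [in RHS](addrC (_%:R)) enum_valK eqxx [b == a]eq_sym.
by rewrite mulr_natr.
Qed.

Lemma mul_src_mx (f : 'rV[K]_#|V|) (a : 'I_#|arrow e|) :
  (f *m (src_mx)^T) 0 a = f 0 (enum_rank (src (enum_val a))).
Proof.
rewrite mxE; set x := src _.
rewrite -(sum_vertex_delta (fun y => f 0 (enum_rank y)) x).
by apply: eq_bigr => i _; rewrite !mxE enum_valK mulrC.
Qed.

Lemma thetaE : theta e K = const_mx 1 *m (src_mx)^T.
Proof.
apply/rowP => a; rewrite mul_src_mx mxE summxE (bigD1 (enum_val a)) //=.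
rewrite big1 => [|b ne_b]; first by rewrite !mxE enum_valK !eqxx addr0.
by rewrite mxE /=; case: (a =P _) => // ab; rewrite ab enum_rankK eqxx in ne_b.
Qed.

Lemma src_mx_inj (f : 'rV[K]_#|V|) : (forall x, 0 < deg e x)%N ->
  f *m (src_mx)^T = 0 -> f = 0.
Proof.
move=> deg0 /rowP f0; apply/rowP => i; rewrite mxE.
have /card_gt0P[y exy] := deg0 (enum_val i).
have := f0 (enum_rank (Sub (enum_val i, y) exy : arrow e)).
by rewrite mul_src_mx enum_rankK enum_valK mxE.
Qed.

Lemma const_graph_laplacian c :
  (const_mx c : 'rV[K]_#|V|) *m (2%:R *: graph_laplacian_mx e K) = 0.
Proof.
have -> : const_mx c = \row_(i < #|V|) (fun=> c : K) (enum_val i).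
  by apply/rowP => i; rewrite !mxE.
rewrite -scalemxAr graph_laplacian_mxE; apply/rowP => i; rewrite !mxE /graph_laplacian.
by rewrite big1 ?mulr0 // => y _; rewrite subrr.
Qed.

Hypothesis e_sym : symmetric e.

Lemma graph_laplacian_mx_entry i j :
  graph_laplacian_mx e K i j =
  (deg e (enum_val i))%:R *+ (i == j) - (e (enum_val i) (enum_val j))%:R.
Proof.
rewrite mxE /graph_laplacian sumrB; congr (_ - _).
  rewrite sumr_const (inj_eq enum_val_inj) eq_sym; case: eqP => [->|_].
    by rewrite mulr1n.
  by rewrite mul0rn.
rewrite e_sym big_mkcond (bigD1 (enum_val i)) //= eqxx big1 => [|y /negPf ->].
  by rewrite addr0; case: (e _ _).
by case: (e _ _).
Qed.

Lemma src_mx_src : src_mx^T *m src_mx = diag_mx deg_row.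
Proof.
apply/matrixP => i j; rewrite !mxE.
under eq_bigr => a _ do rewrite !mxE.
rewrite (big_arrow _ (fun x _ => (x == enum_val i)%:R * (x == enum_val j)%:R)).
under eq_bigr => x _ do rewrite sumr_const.
rewrite (bigD1 (enum_val i)) //= eqxx mul1r big1 ?addr0 => [|x /negPf ->].
  by rewrite (inj_eq enum_val_inj); case: eqP => _; rewrite ?mul0rn.
by rewrite mul0r mul0rn.
Qed.

Lemma src_mx_tgt i j :
  (src_mx^T *m tgt_mx) i j = (e (enum_val i) (enum_val j))%:R.
Proof.
rewrite mxE; under eq_bigr => a _ do rewrite !mxE.
rewrite (big_arrow _ (fun x y => (x == enum_val i)%:R * (y == enum_val j)%:R)).
rewrite (bigD1 (enum_val i)) //= eqxx [X in _ + X]big1 ?addr0 => [|x /negPf ->].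
  rewrite big_mkcond (bigD1 (enum_val j)) //= eqxx big1 ?addr0 => [|y /negPf ->].
    by rewrite mul1r; case: (e _ _).
  by rewrite mulr0; case: (e _ _).
by rewrite big1 // => y _; rewrite mul0r.
Qed.

Lemma double_graph_laplacian_mxE :
  2%:R *: graph_laplacian_mx e K =
  diag_mx deg_row + src_mx^T *m (src_mx - 2%:R *: tgt_mx).
Proof.
rewrite mulmxBr src_mx_src -scalemxAr addrA.
have -> : src_mx^T *m tgt_mx = diag_mx deg_row - graph_laplacian_mx e K.
  apply/matrixP => i j; rewrite src_mx_tgt [RHS]mxE [X in _ + X]mxE.
  by rewrite graph_laplacian_mx_entry !mxE opprB addrC subrK.
by rewrite scalerBr opprB !scaler_nat !mulr2n [RHS]addrC subrK.
Qed.

(** The pullback along the source map intertwines 2 L and Delta. *)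
Lemma src_mx_edge_laplacian :
  src_mx^T *m edge_laplacian_mx e K =
  (2%:R *: graph_laplacian_mx e K) *m src_mx^T.
Proof.
rewrite edge_laplacian_mxE double_graph_laplacian_mxE.
exact: lowrank_intertwine src_mx_deg.
Qed.

Lemma char_poly_edge_laplacian : (forall x, 0 < deg e x)%N ->
  char_poly (edge_laplacian_mx e K) =
  char_poly (2%:R *: graph_laplacian_mx e K)
  * \prod_x ('X - (deg e x)%:R%:P) ^+ (deg e x).-1.
Proof.
move=> deg_gt0.
have chD : char_poly (diag_mx deg_row) = \prod_x ('X - (deg e x)%:R%:P).
  rewrite char_poly_diag.
  under eq_bigr => i _ do rewrite mxE.
  by rewrite -(big_enum_val (fun x => 'X - (deg e x)%:R%:P)).
have D0 : char_poly (diag_mx deg_row) != 0 by rewrite monic_neq0 ?char_poly_monic.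
apply: (mulfI D0); rewrite edge_laplacian_mxE double_graph_laplacian_mxE.
rewrite (char_poly_lowrank _ src_mx_deg) mulrCA mulrC; congr (_ * _).
rewrite chD -big_split char_poly_diag /=.
under eq_bigr => i _ do rewrite mxE.
rewrite (big_arrow _ (fun x _ => 'X - (deg e x)%:R%:P)).
by apply: eq_bigr => x _; rewrite prodr_const -exprS prednK.
Qed.

Lemma spectrum_edge_laplacian a : (forall x, 0 < deg e x)%N ->
  spectrum (edge_laplacian_mx e K) a =
  (spectrum (2%:R *: graph_laplacian_mx e K) a + degree_spectrum e K a)%N.
Proof.
move=> deg_gt0; rewrite /spectrum char_poly_edge_laplacian // mupM.
- by rewrite mup_prod_XsubC.
- by rewrite monic_neq0 ?char_poly_monic.
- by apply/prodf_neq0 => x _; rewrite expf_neq0 // polyXsubC_eq0.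
Qed.

Lemma trmx_graph_laplacian : (graph_laplacian_mx e K)^T = graph_laplacian_mx e K.
Proof.
apply/matrixP => i j; rewrite mxE !graph_laplacian_mx_entry e_sym eq_sym.
by case: eqP => [->|].
Qed.

End Incidence.

Section ScalarExtension.
Variables (V : finType) (e : rel V) (k K : fieldType) (iota : {rmorphism k -> K}).

Lemma map_graph_laplacian_mx :
  map_mx iota (2%:R *: graph_laplacian_mx e k) = 2%:R *: graph_laplacian_mx e K.
Proof.
apply/matrixP => i j; rewrite !mxE rmorphM rmorph_nat rmorph_sum; congr (_ * _).
by apply: eq_bigr => y _; rewrite rmorphB !rmorph_nat.
Qed.

Lemma map_edge_laplacian_mx :
  map_mx iota (edge_laplacian_mx e k) = edge_laplacian_mx e K.
Proof.
have map_src : map_mx iota (src_mx e k) = src_mx e K.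
  by apply/matrixP => a x; rewrite !mxE rmorph_nat.
have map_tgt : map_mx iota (tgt_mx e k) = tgt_mx e K.
  by apply/matrixP => a x; rewrite !mxE rmorph_nat.
rewrite !edge_laplacian_mxE map_mxD map_mxM map_mxB map_mxZ -map_trmx rmorph_nat.
rewrite map_src map_tgt map_diag_mx; congr (diag_mx _ + _).
by apply/rowP => a; rewrite !mxE rmorph_nat.
Qed.

End ScalarExtension.

(** * The kernel and the sign of the graph Laplacian *)

Lemma deg_gt0 (V : finType) (e : rel V) : graph_connected e -> (1 < #|V|)%N ->
  forall x, (0 < deg e x)%N.
Proof.
move=> conn V_gt1 x; have /pred0Pn[y /= ne_yx] : #|predC1 x| != 0%N.
  by rewrite -lt0n cardC1 -subn1 subn_gt0.
have /connectP[[|z p] /= xp y_last] := conn x y.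
  by rewrite y_last eqxx in ne_yx.
by apply/card_gt0P; exists z; case/andP: xp.
Qed.

Section Dirichlet.
Variables (V : finType) (e : rel V) (R : realFieldType).
Hypothesis e_sym : symmetric e.

(** Exchanging the two ends of each arrow turns the sum of (f x - f y) f x into
    the sum of (f y - f x) f y; add the two. *)
Lemma dirichlet_form (f : V -> R) :
  2%:R * \sum_x graph_laplacian e f x * f x =
  \sum_x \sum_(y | e x y) (f x - f y) ^+ 2.
Proof.
rewrite mulr_natl mulr2n.
have -> : \sum_x graph_laplacian e f x * f x =
          \sum_x \sum_(y | e x y) (f x - f y) * f x.
  by apply: eq_bigr => x _; rewrite mulr_suml.
rewrite {2}(exchange_big_dep xpredT) //= -big_split; apply: eq_bigr => x _ /=.
rewrite [X in _ + X](eq_bigl (e x)) => [|y]; last by rewrite e_sym.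
by rewrite -big_split; apply: eq_bigr => y _ /=; ring.
Qed.

Hypothesis e_conn : graph_connected e.

Lemma dirichlet_form_eq0 (f : V -> R) :
  \sum_x \sum_(y | e x y) (f x - f y) ^+ 2 = 0 -> forall x y, f x = f y.
Proof.
move=> f0; have step x y : e x y -> f x = f y.
  move=> exy; apply/eqP; rewrite -subr_eq0 -sqrf_eq0.
  have ge0 z : true -> 0 <= \sum_(t | e z t) (f z - f t) ^+ 2.
    by move=> _; apply: sumr_ge0 => t _; apply: sqr_ge0.
  have /psumr_eq0P := psumr_eq0P ge0 f0 (isT : xpredT x).
  by move=> -> // t _; apply: sqr_ge0.
move=> x y; have /connectP[p xp ->] := e_conn x y.
by elim: p x xp => //= z p IHp x /andP[/step -> /IHp].
Qed.

End Dirichlet.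

(** * Spectrum and normal forms over the reals *)

Section Real.
Variables (V : finType) (e : rel V) (R : rcfType).
Hypothesis e_sym : symmetric e.

Lemma double_graph_laplacian_diag :
  exists2 P : 'M[R]_#|V|, P \in unitmx &
    exists d, P *m (2%:R *: graph_laplacian_mx e R) = diag_mx d *m P.
Proof. by apply: real_symmetric_diag; rewrite linearZ /= trmx_graph_laplacian. Qed.

Lemma eigen_graph_laplacian (f : V -> R) (c : R) :
  (forall x, 2%:R * graph_laplacian e f x = c * f x) ->
  c * \sum_x f x ^+ 2 = \sum_x \sum_(y | e x y) (f x - f y) ^+ 2.
Proof.
move=> fE; rewrite -dirichlet_form // !mulr_sumr.
by apply: eq_bigr => x _; rewrite mulrA fE expr2 mulrA.
Qed.

Lemma eigenrow_graph_laplacian (w : 'rV[R]_#|V|) c :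
  w *m (2%:R *: graph_laplacian_mx e R) = c *: w ->
  forall x, let f z := w 0 (enum_rank z) in
  2%:R * graph_laplacian e f x = c * f x.
Proof.
move=> wE x f; have wf : w = \row_i f (enum_val i).
  by apply/rowP => i; rewrite mxE /f enum_valK.
move: wE; rewrite -scalemxAr {1}wf graph_laplacian_mxE => /rowP/(_ (enum_rank x)).
by rewrite !mxE enum_rankK.
Qed.

Lemma eigenvalue_graph_laplacian_ge0 c :
  eigenvalue (2%:R *: graph_laplacian_mx e R) c -> 0 <= c.
Proof.
move=> /eigenvalueP[w wE w0].
pose f z := w 0 (enum_rank z).
have fE := eigen_graph_laplacian (eigenrow_graph_laplacian wE : forall x, _ = c * f x).
have f2 : 0 < \sum_x f x ^+ 2.
  have [i wi] : exists i, w 0 i != 0 by apply/rV0Pn.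
  rewrite (bigD1 (enum_val i)) //= ltr_pwDl ?sumr_ge0 // => [|x _].
    by rewrite /f enum_valK exprn_even_gt0.
  exact: sqr_ge0.
rewrite -(pmulr_lge0 _ f2) fE.
by apply: sumr_ge0 => x _; apply: sumr_ge0 => y _; apply: sqr_ge0.
Qed.

Hypothesis e_conn : graph_connected e.

(** Harmonic functions have vanishing Dirichlet form, hence are equal across
    each edge, hence constant by connectedness. *)
Lemma ker_graph_laplacian (w : 'rV[R]_#|V|) :
  w *m (2%:R *: graph_laplacian_mx e R) = 0 -> exists c, w = const_mx c.
Proof.
rewrite -(scale0r w) => /eigenrow_graph_laplacian/eigen_graph_laplacian.
rewrite mul0r => /esym/(dirichlet_form_eq0 e_conn) f_const.
have [i _|no] := pickP (fun _ : 'I_#|V| => true); last first.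
  by exists 0; apply/rowP => i; have := no i.
exists (w 0 i); apply/rowP => j; rewrite mxE.
by have := f_const (enum_val j) (enum_val i); rewrite !enum_valK.
Qed.

(** In an eigenbasis the multiplicity counts the zero diagonal entries; two of
    them would give two proportional basis vectors. *)
Lemma spectrum_graph_laplacian0 : (0 < #|V|)%N ->
  spectrum (2%:R *: graph_laplacian_mx e R) 0 = 1%N.
Proof.
move=> V_gt0; set H := 2%:R *: _.
have [P Pu [d PH]] := double_graph_laplacian_diag.
have row_const i : d 0 i = 0 -> exists2 c, row i P = const_mx c & c != 0.
  move=> di; have : row i P *m H = 0.
    by rewrite -row_mul PH mul_diag_mx; apply/rowP => k; rewrite !mxE di mul0r.
  case/ker_graph_laplacian => c Pi; exists c => //; apply: contraTneq Pu => c0.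
  rewrite -row_free_unit -kermx_eq0; apply/rowV0Pn.
  exists (delta_mx 0 i); first by apply/sub_kermxP; rewrite -rowE Pi c0.
  by apply/rV0Pn; exists i; rewrite mxE !eqxx oner_eq0.
have chH : char_poly H = \prod_i ('X - (d 0 i)%:P) ^+ 1.
  by rewrite (char_poly_similar Pu PH) char_poly_diag.
have [i di0] : exists i, d 0 i == 0.
  have : eigenvalue H 0.
    apply/eigenvalueP; exists (const_mx 1).
      by rewrite const_graph_laplacian scale0r.
    by apply/rV0Pn; exists (Ordinal V_gt0); rewrite mxE oner_eq0.
  rewrite eigenvalue_root_char chH => /rootP/eqP; rewrite horner_prod => /prodf_eq0[i _].
  by rewrite !hornerE oppr_eq0; exists i.
rewrite /spectrum chH mup_prod_XsubC (bigD1 i) //= big_pred0 // => j.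
apply/negbTE/negP => /andP[/eqP dj ne_ji].
have [c Pi c0] := row_const i (eqP di0); have [c' Pj _] := row_const j dj.
have /(row_free_inj (_ : row_free P)) :
    (c' *: delta_mx 0 i : 'rV_#|V|) *m P = (c *: delta_mx 0 j) *m P.
  rewrite -!scalemxAl -!rowE Pi Pj; apply/rowP => k.
  by rewrite !mxE mulrC.
rewrite row_free_unit => /(_ Pu) /rowP/(_ j).
rewrite !mxE !eqxx (negPf ne_ji) mulr0 mulr1 => c_0.
by rewrite -c_0 eqxx in c0.
Qed.

Lemma spectrum_edge_laplacian0 : (1 < #|V|)%N ->
  spectrum (edge_laplacian_mx e R) 0 = 1%N.
Proof.
move=> V_gt1; have deg0 := deg_gt0 e_conn V_gt1.
rewrite spectrum_edge_laplacian // spectrum_graph_laplacian0 ?(ltnW V_gt1) //.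
by rewrite /degree_spectrum big_pred0 // => x; rewrite pnatr_eq0 gtn_eqF.
Qed.

Lemma edge_laplacian_trigonalizable : (1 < #|V|)%N ->
  trigonalizable (edge_laplacian_mx e R).
Proof.
move=> V_gt1; have deg0 := deg_gt0 e_conn V_gt1.
have [P Pu [d PH]] := double_graph_laplacian_diag.
pose rs := [seq d 0 i | i <- enum 'I_#|V|]
           ++ flatten [seq nseq (deg e x).-1 (deg e x)%:R | x <- enum V].
apply: (@trigonalizable_split _ _ _ rs).
rewrite char_poly_edge_laplacian // (char_poly_similar Pu PH) char_poly_diag.
rewrite big_cat big_map big_enum big_flatten big_map big_enum /=; congr (_ * _).
by apply: eq_bigr => x _; rewrite big_nseq iter_mulr_1.
Qed.

(** A null vector u satisfies u E = - u (S - 2 T) S^T; as E is invertible and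
    S^T E = D S^T, this makes u the pullback of a function f, and then
    0 = u Delta = f (2 L) S^T forces f to be constant. *)
Lemma eigenspace_edge_laplacian0 : (1 < #|V|)%N ->
  (eigenspace (edge_laplacian_mx e R) 0 :=: theta e R)%MS.
Proof.
move=> V_gt1; have deg0 := deg_gt0 e_conn V_gt1.
apply/eqmxP/andP; split; last first.
  apply/eigenspaceP; rewrite scale0r thetaE -mulmxA src_mx_edge_laplacian // mulmxA.
  by rewrite const_graph_laplacian mul0mx.
apply/row_subP => i.
have /eigenspaceP := row_sub i (eigenspace (edge_laplacian_mx e R) 0).
move: (row i _) => u; rewrite scale0r => uM.
pose g := u *m (src_mx e R - 2%:R *: tgt_mx e R).
pose f : 'rV_#|V| := \row_x (- g 0 x / (deg e (enum_val x))%:R).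
have uE : u = f *m (src_mx e R)^T.
  have /eqP := uM; rewrite edge_laplacian_mxE mulmxDr mulmxA -/g addr_eq0.
  move=> /eqP/rowP ug; apply/rowP => a; have := ug a.
  rewrite mul_mx_diag [LHS]mxE [RHS]mxE mul_src_mx [src_deg_row _ _ _ _]mxE => uga.
  by rewrite mul_src_mx [RHS]mxE enum_rankK -uga mulfK // pnatr_eq0 -lt0n.
have /ker_graph_laplacian[c fc] : f *m (2%:R *: graph_laplacian_mx e R) = 0.
  apply: (src_mx_inj deg0).
  by rewrite -mulmxA -src_mx_edge_laplacian // mulmxA -uE uM.
rewrite uE fc thetaE -[c]mulr1 -scalemx_const -scalemxAl; exact: scalemx_sub.
Qed.

Lemma edge_laplacian_eigenvalue_gt0 a : (1 < #|V|)%N ->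
  (0 < spectrum (edge_laplacian_mx e R) a)%N -> a != 0 -> 0 < a.
Proof.
move=> V_gt1; have deg0 := deg_gt0 e_conn V_gt1.
rewrite spectrum_edge_laplacian // addn_gt0 => /orP[|].
  by rewrite spectrum_gt0 lt0r => /eigenvalue_graph_laplacian_ge0 -> ->.
by rewrite lt0n sum_nat_eq0 => /forall_inPn[x /eqP <- _]; rewrite lt0r ler0n => ->.
Qed.

(** Each omega_a is a sum of eigenvectors: a corrected one minus a pullback when
    the source of a has degree at least 2, and a pullback otherwise. *)
Lemma edge_laplacian_diagonalizable :
  multiset_disjoint (spectrum (2%:R *: graph_laplacian_mx e R))
                    (degree_spectrum e R) ->
  diagonalizable (edge_laplacian_mx e R).
Proof.
set H := 2%:R *: _ => disj.
have [P Pu [d PH]] := double_graph_laplacian_diag.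
pose rs := [seq d 0 i | i <- enum 'I_#|V|] ++ [seq (deg e x)%:R | x <- enum V].
pose W := (src_mx e R)^T.
have sub_vertex (g : 'rV_#|V|) :
    (g *m W <= \sum_(r <- undup rs) eigenspace (edge_laplacian_mx e R) r)%MS.
  rewrite -(mulmxKV Pu g) -[_ *m W]mulmxA mulmx_sub //; apply/row_subP => i.
  apply: (@sub_eigensum _ _ _ _ (d 0 i)).
    by rewrite mem_cat map_f ?mem_enum.
  rewrite -row_mul -mulmxA src_mx_edge_laplacian // -/H mulmxA PH -mulmxA.
  by rewrite mul_diag_mx; apply/rowP => k; rewrite !mxE.
apply: (@diagonalizable_eigensum _ _ _ rs); apply/row_subP => a; rewrite row1.
set x := src (enum_val a).
have [deg1|deg_neq1] := eqVneq (deg e x) 1%N.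
  have -> : delta_mx 0 a = delta_mx 0 (enum_rank x) *m W :> 'rV_#|arrow e|.
    apply/rowP => b; rewrite mul_src_mx !mxE !eqxx /=; congr (_%:R).
    rewrite (inj_eq enum_rank_inj); congr nat_of_bool.
    apply/eqP/eqP => [->|src_b] //; apply: enum_val_inj; apply: val_inj.
    have /card_le1_eqP deg_le1 : (deg e x <= 1)%N by rewrite deg1.
    have tgt_b : tgt (enum_val b) = tgt (enum_val a).
      have e_b : e x (tgt (enum_val b)) by rewrite -src_b; apply: (valP (enum_val b)).
      exact: deg_le1 _ _ (valP (enum_val a) : e x _) e_b.
    rewrite [LHS]surjective_pairing [RHS]surjective_pairing.
    exact: (congr2 pair src_b tgt_b).
  exact: sub_vertex.
have deg_gt1 : (1 < deg e x)%N.
  rewrite ltn_neqAle eq_sym deg_neq1; apply/card_gt0P; exists (tgt (enum_val a)).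
  exact: (valP (enum_val a)).
have Edelta : (delta_mx 0 a : 'rV_#|arrow e|) *m diag_mx (src_deg_row e R) =
              (deg e x)%:R *: delta_mx 0 a.
  apply/rowP => b; rewrite mul_mx_diag !mxE eqxx /=.
  by case: eqP => [->|_]; rewrite ?mulr0 ?mul0r // mulrC.
have [|g gM] := eigenvector_lift (N := src_mx e R - 2%:R *: tgt_mx e R)
                                 (src_mx_deg e R) Edelta.
  rewrite -double_graph_laplacian_mxE // -spectrum_gt0; apply/negP => spec_x.
  apply: (disj (deg e x)%:R); split=> //.
  by rewrite /degree_spectrum (bigD1 x) //= addn_gt0 -subn1 subn_gt0 deg_gt1.
rewrite -[delta_mx 0 a](addrK (g *m W)) addmx_sub //.
  apply: (@sub_eigensum _ _ _ _ (deg e x)%:R); last by rewrite edge_laplacian_mxE.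
  by rewrite mem_cat; apply/orP; right; apply/mapP; exists x; rewrite ?mem_enum.
by rewrite eqmx_opp sub_vertex.
Qed.

End Real.

Theorem theorem4p9 (V : finType) (e : rel V)
    (e_sym : symmetric e) (e_irr : irreflexive e) (e_conn : graph_connected e) :
  [/\
   (1 < #|V|)%N ->
     forall (k : fieldType), 2%N \notin [pchar k] ->
     forall (K : fieldType) (iota : {rmorphism k -> K}) (a : K),
       spectrum (map_mx iota (edge_laplacian_mx e k)) a =
       (spectrum (map_mx iota (2%:R *: graph_laplacian_mx e k)) a
        + degree_spectrum e K a)%N,
   (1 < #|V|)%N ->
     forall (R : realType), let Delta := edge_laplacian_mx e R in
       [/\ trigonalizable Delta,
           spectrum Delta 0 = 1%N,
           (eigenspace Delta 0 :=: theta e R)%MS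
         & forall a : R, (0 < spectrum Delta a)%N -> a != 0 -> 0 < a]
   &
   forall (R : realType),
     multiset_disjoint (spectrum (2%:R *: graph_laplacian_mx e R))
                       (degree_spectrum e R) ->
     diagonalizable (edge_laplacian_mx e R)].
Proof.
split=> [V_gt1 k _ K iota a|V_gt1 R|R].
- rewrite map_edge_laplacian_mx map_graph_laplacian_mx.
  exact: (spectrum_edge_laplacian e_sym a (deg_gt0 e_conn V_gt1)).
- split.
  + exact: edge_laplacian_trigonalizable.
  + exact: spectrum_edge_laplacian0.
  + exact: eigenspace_edge_laplacian0.
  + by move=> a; apply: edge_laplacian_eigenvalue_gt0.
- exact: edge_laplacian_diagonalizable.
Qed.
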